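(* Let $(\mathcal{A},\Theta)$ be an extriangulated length category and let $X,Y\in\mathrm{ind}(\mathcal{A})$. Then the Gabriel-Roiter measure $\Theta^{\ast}:\mathrm{ind}(\mathcal{A})\to\mathrm{Ch}(\mathbb{N})$ satisfies the following conditions: (GR1) If $X\le Y$, then $\Theta^{\ast}(X)\le\Theta^{\ast}(Y)$. (GR2) If $\Theta^{\ast}(X)=\Theta^{\ast}(Y)$, then $\Theta(X)=\Theta(Y)$. (GR3) If $\Theta(X)\ge\Theta(Y)$ and $\Theta^{\ast}(X')<\Theta^{\ast}(Y)$ for every $X'\in\mathrm{ind}(\mathcal{A})$ with $X'<X$, then $\Theta^{\ast}(X)\le\Theta^{\ast}(Y)$.
   Context: All categories are skeletally small and Krull-Schmidt; $\mathbb{N}$ contains $0$. Extriangulated categories (Nakaoka-Palu). Let $\mathcal{A}$ be an additive category and $\mathbb{E}:\mathcal{A}^{\mathrm{op}}\times\mathcal{A}\to \mathrm{Ab}$ a biadditive functor. For $\delta\in\mathbb{E}(C,A)$, $a:A\to A'$, $c:C'\to C$ write $a_\ast\delta=\mathbb{E}(C,a)(\delta)$, $c^\ast\delta=\mathbb{E}(c,A)(\delta)$. For $\delta\in\mathbb{E}(C,A)$, $\delta'\in\mathbb{E}(C',A')$, a morphism $(a,c):\delta\to\delta'$ is a pair $a:A\to A'$, $c:C\to C'$ with $a_\ast\delta=c^\ast\delta'$. Sequences $A\to B\to C$ and $A\to B'\to C$ are equivalent if there is an isomorphism $B\to B'$ commuting with the given maps and the identities of $A$, $C$. A realization $\mathfrak{s}$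 assigns to each $\delta\in\mathbb{E}(C,A)$ an equivalence class $\mathfrak{s}(\delta)=[A\xrightarrow{x}B\xrightarrow{y}C]$ such that for every morphism $(a,c):\delta\to\delta'$ with $\mathfrak{s}(\delta')=[A'\xrightarrow{x'}B'\xrightarrow{y'}C']$ there is $b:B\to B'$ with $bx=x'a$, $y'b=cy$ (then $(a,b,c)$ realizes $(a,c)$). It is additive if $\mathfrak{s}(0)=[A\to A\oplus C\to C]$ (canonical maps) and $\mathfrak{s}(\delta\oplus\delta')=\mathfrak{s}(\delta)\oplus\mathfrak{s}(\delta')$. $(\mathcal{A},\mathbb{E},\mathfrak{s})$ is extriangulated if $\mathfrak{s}$ is an additive realization of $\mathbb{E}$ and: (ET3) for $\mathfrak{s}(\delta)=[A\xrightarrow{x}B\xrightarrow{y}C]$, $\mathfrak{s}(\delta')=[A'\xrightarrow{x'}B'\xrightarrow{y'}C']$ and $a,b$ with $bx=x'a$ there is $c$ such that $(a,c):\delta\to\delta'$ is a morphism realized by $(a,b,c)$; (ET4) for $\delta\in\mathbb{E}(D,A)$, $\delta'\in\mathbb{E}(F,B)$ realized by $A\xrightarrow{f}B\xrightarrow{f'}D$ and $B\xrightarrow{g}C\xrightarrow{g'}F$ there are an object $E$, morphisms $h=gf:A\to C$, $h':C\to E$, $d:D\to E$, $e:E\to F$ with $h'g=df'$, $eh'=g'$, and $\delta''\in\mathbb{E}(E,A)$ realized by $A\xrightarrow{h}C\xrightarrow{h'}E$, such that $D\xrightarrow{d}E\xrightarrow{e}F$ realizes $f'_\ast\delta'$,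 $d^\ast\delta''=\delta$ and $f_\ast\delta''=e^\ast\delta'$; and the duals of (ET3), (ET4) hold. If $\mathfrak{s}(\delta)=[A\xrightarrow{x}B\xrightarrow{y}C]$, then $A\xrightarrow{x}B\xrightarrow{y}C\overset{\delta}{\dashrightarrow}$ is called an $\mathbb{E}$-triangle. Length categories. $\mathrm{Iso}(\mathcal{A})$ is the set of isomorphism classes of objects. A length function is a map $\Theta:\mathrm{Iso}(\mathcal{A})\to\mathbb{N}$ with $\Theta(X)=0$ iff $X\cong 0$, and $\Theta(L)\le\Theta(X)+\Theta(M)$ for every $\mathbb{E}$-triangle $X\to L\to M\overset{\delta}{\dashrightarrow}$, with equality if $\delta=0$. An $\mathbb{E}$-triangle $X\xrightarrow{x}L\xrightarrow{y}M\dashrightarrow$ is stable if $\Theta(L)=\Theta(X)+\Theta(M)$; then $x$ is a $\Theta$-inflation and $y$ a $\Theta$-deflation. A morphism is $\Theta$-admissible if it factors as a $\Theta$-deflation followed by a $\Theta$-inflation. $((\mathcal{A},\mathbb{E},\mathfrak{s}),\Theta)$, written $(\mathcal{A},\Theta)$, is an (extriangulated) length category if every morphism of $\mathcal{A}$ is $\Theta$-admissible. Gabriel-Roiter measure. $\mathrm{ind}(\mathcal{A})$ is the set of isomorphism classes of indecomposable objects, partially ordered by $X\le Y$ iff there is a $\Theta$-inflation $X\to Y$; $X<Y$ means $X\le Y$ and $X\not\cong Y$. For a poset $P$, $\mathrm{Ch}(P)$ is the set of finite totally ordered subsets of $P$, and $\mathrm{Ch}(P,x)$ the set of those with maximal element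 $x$. $\mathrm{Ch}(\mathbb{N})$ carries the (total) lexicographical order: $\mathbf{X}\le\mathbf{Y}$ iff $\min(\mathbf{Y}\setminus\mathbf{X})\le\min(\mathbf{X}\setminus\mathbf{Y})$, where $\min\emptyset$ is larger than every element of $\mathbb{N}$. The Gabriel-Roiter measure is $\Theta^{\ast}:\mathrm{ind}(\mathcal{A})\to\mathrm{Ch}(\mathbb{N})$, $\Theta^{\ast}(X)=\max\{\Theta(\mathbf{X})\mid\mathbf{X}\in\mathrm{Ch}(\mathrm{ind}(\mathcal{A}),X)\}$, where $\Theta(\mathbf{X})=\{\Theta(X')\mid X'\in\mathbf{X}\}$. *)

(* Defs.v *)
From HB Require Import structures.
From mathcomp Require Import all_boot all_order all_algebra.
From mathcomp Require Import finmap.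
From mathcomp Require Import boolp classical_sets.

Set Implicit Arguments.
Unset Strict Implicit.
Unset Printing Implicit Defensive.

Import GRing.Theory.

Local Open Scope ring_scope.
Local Open Scope classical_set_scope.

(** * Additive and Krull-Schmidt categories *)

(* A category is given by a type of objects, so it is small in the universe of
   that type; this is the reading of "skeletally small". *)
Record preaddCat := PreaddCat {
  obj :> Type;
  hom : obj -> obj -> zmodType;
  idm : forall X, hom X X;
  comp : forall X Y Z, hom Y Z -> hom X Y -> hom X Z;
  comp1m : forall X Y (f : hom X Y), comp (idm Y) f = f;
  compm1 : forall X Y (f : hom X Y), comp f (idm X) = f;
  compA : forall X Y Z W (h : hom Z W) (g : hom Y Z) (f : hom X Y),
    comp h (comp g f) = comp (comp h g) f;
  compDl : forall X Y Z (g g' : hom Y Z) (f : hom X Y),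
    comp (g + g') f = comp g f + comp g' f;
  compDr : forall X Y Z (g : hom Y Z) (f f' : hom X Y),
    comp g (f + f') = comp g f + comp g f'
}.

Arguments hom {p} X Y.
Arguments idm {p} X.
Arguments comp {p X Y Z} g f.

Notation "g \oc f" := (comp g f) (at level 40, left associativity).

Section Additive.
Variable A : preaddCat.
Implicit Types X Y Z : A.

Definition is_iso X Y (f : hom X Y) : Prop :=
  exists g : hom Y X, g \oc f = idm X /\ f \oc g = idm Y.

Definition isomorphic X Y : Prop := exists f : hom X Y, is_iso f.

Definition is_zero_obj X : Prop :=
  forall Y, (forall f : hom X Y, f = 0) /\ (forall g : hom Y X, g = 0).

Record biprod X Y := Biprod {
  bobj : A;
  in1 : hom X bobj;
  in2 : hom Y bobj;
  pr1 : hom bobj X;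
  pr2 : hom bobj Y;
  pr1_in1 : pr1 \oc in1 = idm X;
  pr2_in2 : pr2 \oc in2 = idm Y;
  pr1_in2 : pr1 \oc in2 = 0;
  pr2_in1 : pr2 \oc in1 = 0;
  biprodE : in1 \oc pr1 + in2 \oc pr2 = idm bobj
}.

Definition additive_cat : Prop :=
  (exists X, is_zero_obj X) /\ (forall X Y, inhabited (biprod X Y)).

Definition is_direct_sum n (Y : 'I_n -> A) X : Prop :=
  exists (u : forall i, hom (Y i) X) (p : forall i, hom X (Y i)),
    [/\ forall i, p i \oc u i = idm (Y i),
        forall i j, i != j -> p i \oc u j = 0
      & \sum_(i < n) u i \oc p i = idm X].

(* The endomorphism ring is local: it is nonzero and its non-invertible
   elements are closed under addition. *)
Definition local_end X : Prop :=
  idm X <> 0 /\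
  forall f g : hom X X, ~ is_iso f -> ~ is_iso g -> ~ is_iso (f + g).

Definition krull_schmidt : Prop :=
  forall X, exists n (Y : 'I_n -> A),
    (forall i, local_end (Y i)) /\ is_direct_sum Y X.

Definition indecomposable X : Prop :=
  ~ is_zero_obj X /\
  forall Y Z (S : biprod Y Z), isomorphic X (bobj S) ->
    is_zero_obj Y \/ is_zero_obj Z.

Lemma isomorphic_refl X : isomorphic X X.
Proof. by exists (idm X), (idm X); rewrite comp1m. Qed.

Lemma isomorphic_sym X Y : isomorphic X Y -> isomorphic Y X.
Proof. by move=> [f [g [gf fg]]]; exists g, f. Qed.

Lemma isomorphic_trans X Y Z :
  isomorphic X Y -> isomorphic Y Z -> isomorphic X Z.
Proof.
move=> [f [g [gf fg]]] [h [k [kh hk]]]; exists (h \oc f), (g \oc k); split.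
  by rewrite compA -(compA g k h) kh compm1.
by rewrite compA -(compA h f g) fg compm1.
Qed.

Definition isob (X Y : {classic A}) : bool := `[< isomorphic X Y >].

Lemma isob_refl : reflexive isob.
Proof. by move=> X; apply/asboolP/isomorphic_refl. Qed.

Lemma isob_sym : symmetric isob.
Proof.
by move=> X Y; apply/asboolP/asboolP; apply: isomorphic_sym.
Qed.

Lemma isob_trans : transitive isob.
Proof.
move=> Y X Z /asboolP XY /asboolP YZ.
by apply/asboolP; apply: isomorphic_trans XY YZ.
Qed.

Canonical isob_equiv := EquivRel isob isob_refl isob_sym isob_trans.

Definition Iso := {eq_quot isob}%qT.

Definition isoclass X : Iso := (\pi_Iso (X : {classic A}))%qT.

(* The notions defined below through this chosen representative are invariant
   under isomorphism. *)
Definition isorep (c : Iso) : A := repr c.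

Definition ind := {c : Iso | `[< indecomposable (isorep c) >]}.

Definition indrep (X : ind) : A := isorep (val X).

End Additive.

Arguments Iso A : clear implicits.
Arguments ind A : clear implicits.

(** * Extriangulated categories *)

Record sequence (A : preaddCat) (X Z : A) := Sequence {
  mid : A;
  seq_in : hom X mid;
  seq_out : hom mid Z
}.

Arguments Sequence {A X Z mid} seq_in seq_out.

Definition seq_equiv (A : preaddCat) (X Z : A) (s t : sequence X Z) : Prop :=
  exists b : hom (mid s) (mid t),
    [/\ is_iso b, b \oc seq_in s = seq_in t & seq_out t \oc b = seq_out s].

(* [Ext C X] is E(C, X), contravariant in [C] and covariant in [X]; [real] is
   the realization. *)
Record extData := ExtData {
  ecat :> preaddCat;
  Ext : ecat -> ecat -> zmodType;
  Emap : forall C C' X X' : ecat, hom C' C -> hom X X' ->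
    {additive Ext C X -> Ext C' X'};
  Emap1 : forall (C X : ecat) (d : Ext C X), Emap (idm C) (idm X) d = d;
  EmapM : forall (C C' C'' X X' X'' : ecat) (c : hom C' C) (c' : hom C'' C')
    (a : hom X X') (a' : hom X' X'') (d : Ext C X),
    Emap (c \oc c') (a' \oc a) d = Emap c' a' (Emap c a d);
  EmapDl : forall (C C' X X' : ecat) (c c' : hom C' C) (a : hom X X')
    (d : Ext C X), Emap (c + c') a d = Emap c a d + Emap c' a d;
  EmapDr : forall (C C' X X' : ecat) (c : hom C' C) (a a' : hom X X')
    (d : Ext C X), Emap c (a + a') d = Emap c a d + Emap c a' d;
  real : forall C X : ecat, Ext C X -> set (sequence X C)
}.

Arguments Ext {e} C X.
Arguments Emap {e C C' X X'} c a.
Arguments real {e C X} d.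

Section Extriangulated.
Variable A : extData.

Definition push (C X X' : A) (a : hom X X') (d : Ext C X) : Ext C X' :=
  Emap (idm C) a d.

Definition pull (C C' X : A) (c : hom C' C) (d : Ext C X) : Ext C' X :=
  Emap c (idm X) d.

Definition triangle (X L M : A) (x : hom X L) (y : hom L M) (d : Ext M X) :
    Prop :=
  real d (Sequence x y).

Definition ext_morphism (C X C' X' : A) (a : hom X X') (c : hom C C')
    (d : Ext C X) (d' : Ext C' X') : Prop :=
  push a d = pull c d'.

Definition is_realization : Prop :=
  (forall (C X : A) (d : Ext C X),
     exists s, real d = [set t | seq_equiv s t]) /\
  (forall (X B C X' B' C' : A) (x : hom X B) (y : hom B C) (d : Ext C X)
     (x' : hom X' B') (y' : hom B' C') (d' : Ext C' X')
     (a : hom X X') (c : hom C C'),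
     triangle x y d -> triangle x' y' d' -> ext_morphism a c d d' ->
     exists b : hom B B', b \oc x = x' \oc a /\ y' \oc b = c \oc y).

Definition biprod_hom (X X' Y Y' : A) (S : biprod X X') (T : biprod Y Y')
    (f : hom X Y) (f' : hom X' Y') : hom (bobj S) (bobj T) :=
  in1 T \oc f \oc pr1 S + in2 T \oc f' \oc pr2 S.

(* The element of E(C (+) C', X (+) X') with components (d, 0, 0, d'). *)
Definition ext_sum (C C' X X' : A) (SC : biprod C C') (SX : biprod X X')
    (d : Ext C X) (d' : Ext C' X') : Ext (bobj SC) (bobj SX) :=
  Emap (pr1 SC) (in1 SX) d + Emap (pr2 SC) (in2 SX) d'.

Definition additive_realization : Prop :=
  (forall (X C : A) (S : biprod X C),
     triangle (in1 S) (pr2 S) (0 : Ext C X)) /\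
  (forall (X B C X' B' C' : A) (SX : biprod X X') (SB : biprod B B')
     (SC : biprod C C') (x : hom X B) (y : hom B C) (d : Ext C X)
     (x' : hom X' B') (y' : hom B' C') (d' : Ext C' X'),
     triangle x y d -> triangle x' y' d' ->
     triangle (biprod_hom SX SB x x') (biprod_hom SB SC y y')
       (ext_sum SC SX d d')).

Definition ET3 : Prop :=
  forall (X B C X' B' C' : A) (x : hom X B) (y : hom B C) (d : Ext C X)
    (x' : hom X' B') (y' : hom B' C') (d' : Ext C' X')
    (a : hom X X') (b : hom B B'),
    triangle x y d -> triangle x' y' d' -> b \oc x = x' \oc a ->
    exists c : hom C C', ext_morphism a c d d' /\ y' \oc b = c \oc y.

Definition ET3op : Prop :=
  forall (X B C X' B' C' : A) (x : hom X B) (y : hom B C) (d : Ext C X)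
    (x' : hom X' B') (y' : hom B' C') (d' : Ext C' X')
    (b : hom B B') (c : hom C C'),
    triangle x y d -> triangle x' y' d' -> y' \oc b = c \oc y ->
    exists a : hom X X', ext_morphism a c d d' /\ b \oc x = x' \oc a.

Definition ET4 : Prop :=
  forall (X B D C F : A) (f : hom X B) (f' : hom B D) (d : Ext D X)
    (g : hom B C) (g' : hom C F) (d' : Ext F B),
    triangle f f' d -> triangle g g' d' ->
    exists (E : A) (h' : hom C E) (u : hom D E) (v : hom E F) (d'' : Ext E X),
      [/\ h' \oc g = u \oc f' /\ v \oc h' = g',
          triangle (g \oc f) h' d'',
          triangle u v (push f' d'),
          pull u d'' = d
        & push f d'' = pull v d'].

(* [ET4] in the opposite category: all arrows reversed, the arguments of [Ext]
   exchanged, hence [push] and [pull] exchanged. *)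
Definition ET4op : Prop :=
  forall (X B D C F : A) (f : hom B X) (f' : hom D B) (d : Ext X D)
    (g : hom C B) (g' : hom F C) (d' : Ext B F),
    triangle f' f d -> triangle g' g d' ->
    exists (E : A) (h' : hom E C) (u : hom E D) (v : hom F E) (d'' : Ext X E),
      [/\ g \oc h' = f' \oc u /\ h' \oc v = g',
          triangle h' (f \oc g) d'',
          triangle v u (pull f' d'),
          push u d'' = d
        & pull f d'' = push v d'].

Definition extriangulated : Prop :=
  additive_cat A /\ is_realization /\ additive_realization /\
  ET3 /\ ET3op /\ ET4 /\ ET4op.

(** * Length categories *)

Definition length_function (Theta : Iso A -> nat) : Prop :=
  [/\ forall X : A, Theta (isoclass X) = 0%N <-> is_zero_obj X,
      forall (X L M : A) (x : hom X L) (y : hom L M) (d : Ext M X),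
        triangle x y d ->
        (Theta (isoclass L) <= Theta (isoclass X) + Theta (isoclass M))%N
    & forall (X L M : A) (x : hom X L) (y : hom L M),
        triangle x y (0 : Ext M X) ->
        Theta (isoclass L) = (Theta (isoclass X) + Theta (isoclass M))%N].

Variable Theta : Iso A -> nat.

Definition stable_triangle (X L M : A) (x : hom X L) (y : hom L M)
    (d : Ext M X) : Prop :=
  triangle x y d /\
  Theta (isoclass L) = (Theta (isoclass X) + Theta (isoclass M))%N.

Definition inflation (X L : A) (x : hom X L) : Prop :=
  exists (M : A) (y : hom L M) (d : Ext M X), stable_triangle x y d.

Definition deflation (L M : A) (y : hom L M) : Prop :=
  exists (X : A) (x : hom X L) (d : Ext M X), stable_triangle x y d.

Definition admissible (X Y : A) (f : hom X Y) : Prop :=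
  exists (Z : A) (p : hom X Z) (i : hom Z Y),
    [/\ deflation p, inflation i & f = i \oc p].

Definition length_category : Prop :=
  [/\ extriangulated, krull_schmidt A, length_function Theta
    & forall (X Y : A) (f : hom X Y), admissible f].

(** * The Gabriel-Roiter measure *)

Definition ind_le (X Y : ind A) : Prop :=
  exists x : hom (indrep X) (indrep Y), inflation x.

Definition ind_lt (X Y : ind A) : Prop := ind_le X Y /\ X <> Y.

Definition ind_length (X : ind A) : nat := Theta (val X).

Definition Ch_ind : set {fset ind A} :=
  [set S | forall Y Z, Y \in S -> Z \in S -> ind_le Y Z \/ ind_le Z Y].

Definition Ch_ind_max (X : ind A) : set {fset ind A} :=
  [set S | [/\ Ch_ind S, X \in S & forall Y, Y \in S -> ~ ind_lt X Y]].

Definition chain_length (S : {fset ind A}) : {fset nat} :=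
  [fset ind_length X | X in S]%fset.

End Extriangulated.

(* Every subset of nat is totally ordered, so Ch(nat) is [{fset nat}]; [None]
   stands for the minimum of the empty set, larger than every number. *)
Definition fmin (S : {fset nat}) : option nat := ohead (sort leq S).

Definition ole (m n : option nat) : bool :=
  match m, n with
  | _, None => true
  | None, Some _ => false
  | Some m, Some n => (m <= n)%N
  end.

Definition lex_le (S T : {fset nat}) : bool :=
  ole (fmin (T `\` S)%fset) (fmin (S `\` T)%fset).

Definition lex_lt (S T : {fset nat}) : bool := lex_le S T && (S != T).

(* The set below is not empty in a length category: the lexicographical order
   is total and every chain with maximal element [X] has lengths at most that
   of [X]; the default value [fset0] plays no role. *)
Definition GR_measure (A : extData) (Theta : Iso A -> nat) (X : ind A) :
    {fset nat} :=
  let lengths := chain_length Theta @` Ch_ind_max Theta X in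
  xget fset0 [set m | lengths m /\ forall m', lengths m' -> lex_le m' m].

(* Main.v *)
(** Stable triangles compose by (ET4), and a stable triangle with zero cone
    splits, so [ind_le] is a partial order along which the length is strictly
    increasing.  Hence a chain with maximal element [X] has lengths at most that
    of [X], and the maximum defining the measure exists.  For (GR3), remove [X]
    from a chain realizing the measure of [X]: the remaining lengths [U] are
    lexicographically smaller than the measure [V] of [Y], and adding a number
    [n > max U] with [n >= max V] to [U] cannot move it beyond [V]. *)
Require Import Defs.
From mathcomp Require Import all_boot finmap.
From mathcomp Require Import ssralg boolp classical_sets.

Set Implicit Arguments.
Unset Strict Implicit.
Unset Printing Implicit Defensive.

Import GRing.Theory.

(** * The lexicographical order on finite sets of natural numbers, and finite maxima *)

Lemma fmin_none (S : {fset nat}) : fmin S = None -> S = fset0.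
Proof.
rewrite /fmin => h; apply/fsetP => k; rewrite inE.
have <- : (k \in sort leq S) = (k \in S) by rewrite mem_sort.
by case: (sort leq S) h.
Qed.

Lemma fmin_some (S : {fset nat}) m :
  fmin S = Some m -> m \in S /\ forall k, k \in S -> (m <= k)%N.
Proof.
rewrite /fmin => h.
have memS k : (k \in sort leq S) = (k \in S) by rewrite mem_sort.
have := sort_sorted leq_total S.
case: (sort leq S) h memS => //= a s [->] memS /(order_path_min leq_trans).
move=> /allP sle; split; first by rewrite -memS mem_head.
by move=> k; rewrite -memS inE => /orP[/eqP -> //|/sle].
Qed.

(** Trades the two minima for a pointwise criterion suited to strong induction. The least element of
    [T] outside [S] serves every [n] at once; conversely it suffices to test the least element of
    [S] outside [T]. *)
Lemma lex_leP (S T : {fset nat}) :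
  reflect (forall n, n \in S -> n \notin T ->
             exists m, [/\ m \in T, m \notin S & (m < n)%N])
          (lex_le S T).
Proof.
rewrite /lex_le.
have memD (U V : {fset nat}) k : k \in U -> k \notin V -> k \in (U `\` V)%fset.
  by move=> kU kV; rewrite inE kV.
case eT: (fmin (T `\` S)%fset) => [m|]; case eS: (fmin (S `\` T)%fset) => [n|] /=.
- have [+ mle] := fmin_some eT; rewrite inE => /andP[mS mT].
  have [+ nle] := fmin_some eS; rewrite inE => /andP[nT nS].
  apply: (iffP idP) => [mn k kS kT|/(_ n nS nT)[k [kT kS kn]]].
    exists m; split=> //; rewrite ltn_neqAle (leq_trans mn) ?andbT; last first.
      by apply/nle/memD.
    by apply: contraNneq mS => ->.
  by rewrite (leq_trans (mle _ (memD _ _ _ kT kS))) // ltnW.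
- apply: ReflectT => k kS kT; have := memD _ _ _ kS kT.
  by rewrite (fmin_none eS) inE.
- have [+ _] := fmin_some eS; rewrite inE => /andP[nT nS].
  apply: ReflectF => /(_ n nS nT)[k [kT kS _]]; have := memD _ _ _ kT kS.
  by rewrite (fmin_none eT) inE.
- apply: ReflectT => k kS kT; have := memD _ _ _ kS kT.
  by rewrite (fmin_none eS) inE.
Qed.

Lemma lex_le_total : total lex_le.
Proof.
move=> S T; rewrite /lex_le.
by case: (fmin _) (fmin _) => [m|] [n|] //=; exact: leq_total.
Qed.

Lemma lex_le_trans : transitive lex_le.
Proof.
move=> T S V /lex_leP ST /lex_leP TV; apply/lex_leP.
(* The claim covers both kinds of starting point so that the induction can alternate between the two
   hypotheses: each gives a smaller number that is either the desired witness or a starting point of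
   the other kind. *)
have key n : (n \in S) && (n \notin T) || (n \in T) && (n \notin V) ->
    exists m, [/\ m \in V, m \notin S & (m < n)%N].
  elim/ltn_ind: n => n IH.
  have down k : (k < n)%N ->
      (k \in S) && (k \notin T) || (k \in T) && (k \notin V) ->
      exists m, [/\ m \in V, m \notin S & (m < n)%N].
    move=> kn /(IH k kn)[m [? ? mk]].
    by exists m; split=> //; exact: ltn_trans kn.
  move=> /orP[] /andP[].
    move=> nS nT; have [m [mT mS mn]] := ST n nS nT.
    have [mV|mV] := boolP (m \in V); first by exists m.
    by apply: (down m mn); rewrite mT mV orbT.
  move=> nT nV; have [m [mV mT mn]] := TV n nT nV.
  have [mS|mS] := boolP (m \in S); last by exists m.
  by apply: (down m mn); rewrite mS mT.
move=> n nS nV; apply: key; rewrite nS nV andbT /=.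
by case: (n \in T).
Qed.

Lemma lex_le_anti : antisymmetric lex_le.
Proof.
move=> S T /andP[/lex_leP ST /lex_leP TS].
apply/fsetP; elim/ltn_ind => n IH; apply/idP/idP => h; apply: contraT => h'.
  by have [m [mT /negP mS /IH e]] := ST n h h'; rewrite e in mS.
by have [m [mS /negP mT /IH e]] := TS n h h'; rewrite -e in mT.
Qed.

Lemma lex_le_sub (S T : {fset nat}) : {subset S <= T} -> lex_le S T.
Proof. by move=> ST; apply/lex_leP => n /ST ->. Qed.

(** Otherwise [T] is contained in [S], and the criterion of [lex_leP] leaves no element of [S]
    outside [T], so the sets coincide. *)
Lemma lex_lt_ex (S T : {fset nat}) :
  lex_lt S T -> exists2 m, m \in T & m \notin S.
Proof.
move=> /andP[/lex_leP ST]; apply: contraNP => none; apply/eqP/fsetP => k.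
apply/idP/idP => [kS|kT]; apply: contraT => h; case: none.
  by have [m [mT mS _]] := ST k kS h; exists m.
by exists k.
Qed.

Lemma lex_le_fset1U (U V : {fset nat}) n :
  lex_lt U V -> (forall k, k \in U -> (k < n)%N) ->
  (forall k, k \in V -> (k <= n)%N) -> lex_le (n |` U)%fset V.
Proof.
move=> UV Un Vn; have [m mV mU] := lex_lt_ex UV.
have /andP[/lex_leP UleV _] := UV; apply/lex_leP => k.
(* If the new element [n] is not in [V], then [m] differs from [n] and is bounded by it, so [m] is
   the witness. *)
rewrite in_fset1U => /orP[/eqP -> nV|kU kV].
  have mn : m != n by apply: contraNneq nV => <-.
  by exists m; rewrite in_fset1U negb_or mn mU mV ltn_neqAle mn Vn.
(* The old witness survives the insertion, because it lies below an element of [U] and hence below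
   [n]. *)
have [j [jV jU jk]] := UleV k kU kV; exists j; split=> //.
by rewrite in_fset1U negb_or jU (ltn_eqF (ltn_trans jk (Un k kU))).
Qed.

(** Serves twice: for an element of greatest length in a chain, and for the lexicographically
    largest set of lengths. *)
Lemma seq_max (T : eqType) (r : rel T) (P : T -> Prop) (s : seq T) :
  total r -> transitive r -> (exists2 x, x \in s & P x) ->
  exists x, P x /\ forall y, y \in s -> P y -> r y x.
Proof.
move=> rtot rtrans; elim: s => [[]//|a s IH] [x xas Px].
have [[y ys Py]|none] := pselect (exists2 y, y \in s & P y); last first.
  exists x; split=> // y yas Py.
  have eqa z : z \in a :: s -> P z -> z = a.
    by rewrite inE => /orP[/eqP //|zs Pz]; case: none; exists z.
  by rewrite (eqa y) // (eqa x) //; have := rtot a a; rewrite orbb.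
have [z [Pz zmax]] := IH (ex_intro2 _ _ y ys Py).
have [[Pa za]|h] := pselect (P a /\ r z a).
  exists a; split=> // w; rewrite inE => /orP[/eqP -> _|ws Pw].
    by have := rtot a a; rewrite orbb.
  exact: rtrans (zmax w ws Pw) za.
exists z; split=> // w; rewrite inE => /orP[/eqP -> Pa|]; last exact: zmax.
by have /orP[//|za] := rtot a z; case: h.
Qed.

(** * Stable triangles and inflations *)

Section Length.
Variables (A : extData) (Theta : Iso A -> nat).
Hypothesis hA : length_category Theta.
Implicit Types (X Y Z : ind A) (S : {fset ind A}).

Lemma isoclass_indrep X : isoclass (indrep X) = val X.
Proof. exact: reprK. Qed.

Lemma isomorphic_indrep X Y : isomorphic (indrep X) (indrep Y) -> X = Y.
Proof.
move=> XY; apply: val_inj; rewrite -!isoclass_indrep.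
by apply/eqquotP; rewrite /= /isob; apply/asboolP.
Qed.

Local Open Scope ring_scope.

Lemma comp0m (B C D : A) (f : hom B C) : (0 : hom C D) \oc f = 0.
Proof. by apply: (@addrI _ ((0 : hom C D) \oc f)); rewrite -compDl !addr0. Qed.

Lemma compm0 (B C D : A) (f : hom C D) : f \oc (0 : hom B C) = 0.
Proof. by apply: (@addrI _ (f \oc (0 : hom B C))); rewrite -compDr !addr0. Qed.

Lemma Emap0l (C C' B B' : A) (a : hom B B') (d : Ext C B) :
  Emap (0 : hom C' C) a d = 0.
Proof.
by apply: (@addrI _ (Emap (0 : hom C' C) a d)); rewrite -EmapDl !addr0.
Qed.

Lemma zero_cone_triangle (B Z : A) :
  is_zero_obj Z -> triangle (idm B) (0 : hom B Z) (0 : Ext Z B).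
Proof.
move=> Z0; have [[_ [_ [[real0 _] _]]] _ _ _] := hA.
have h1 : (0 : hom B Z) \oc (0 : hom Z B) = idm Z.
  by rewrite comp0m -((Z0 Z).1 (idm Z)).
have h2 : idm B \oc idm B + (0 : hom Z B) \oc (0 : hom B Z) = idm B.
  by rewrite comp1m comp0m addr0.
(* [B] itself is a biproduct of [B] and the zero object [Z]. *)
exact: (real0 _ _ (Biprod (comp1m (idm B)) h1 (compm0 _ _) (comp0m _ _) h2)).
Qed.

(** Since [idm Z] vanishes, so does [d]; the given triangle and that of [zero_cone_triangle] then
    realize the same element, and their middle terms are isomorphic. *)
Lemma zero_cone_iso (B L Z : A) (x : hom B L) (y : hom L Z) (d : Ext Z B) :
  is_zero_obj Z -> triangle x y d -> isomorphic B L.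
Proof.
move=> Z0 tri; have [[_ [[realE _] _]] _ _ _] := hA.
have d0 : d = 0 by rewrite -(Emap1 d) ((Z0 Z).1 (idm Z)) Emap0l.
have := zero_cone_triangle B Z0; move: tri; rewrite /triangle d0.
have [s ->] := realE _ _ (0 : Ext Z B).
case=> b [bi _ _] [c [ci _ _]].
apply: (isomorphic_trans (Y := mid s)); last by exists b.
by apply: isomorphic_sym; exists c.
Qed.

(** (ET4) gives a cone [E] of the composite together with a triangle from [M] to [E] to [N].
    Subadditivity there bounds the length of [E] by those of [M] and [N], which forces equality in
    the triangle of the composite. *)
Lemma inflation_comp (B C D : A) (g : hom C D) (f : hom B C) :
  inflation Theta f -> inflation Theta g -> inflation Theta (g \oc f).
Proof.
have [[_ [_ [_ [_ [_ [et4 _]]]]]] _ [_ Tle _] _] := hA.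
move=> [M [f' [d [tf ef]]]] [N [g' [d' [tg eg]]]].
have [E [h' [u [v [d'' [_ th tE _ _]]]]]] := et4 _ _ _ _ _ _ _ _ _ _ _ tf tg.
exists E, h', d''; split=> //; apply/eqP; rewrite eqn_leq (Tle _ _ _ _ _ _ th).
by rewrite eg ef -addnA leq_add2l (Tle _ _ _ _ _ _ tE).
Qed.

Local Close Scope ring_scope.

(** * The order on indecomposables and its finite chains *)

Lemma ind_le_refl X : ind_le Theta X X.
Proof.
have [[[[Z Z0] _] _] _ [T0 _ _] _] := hA.
exists (idm _), Z, 0%R, 0%R; split; first exact: zero_cone_triangle.
by rewrite ((T0 Z).2 Z0) addn0.
Qed.

Lemma ind_le_trans Y X Z :
  ind_le Theta X Y -> ind_le Theta Y Z -> ind_le Theta X Z.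
Proof. by move=> [f fi] [g gi]; exists (g \oc f); exact: inflation_comp. Qed.

(** Equal lengths would give the stable triangle a cone of length zero, hence a zero cone, and [X]
    and [Y] would be isomorphic. *)
Lemma ind_lt_length X Y :
  ind_lt Theta X Y -> (ind_length Theta X < ind_length Theta Y)%N.
Proof.
have [_ _ [T0 _ _] _] := hA.
case=> [[x [M [y [d [tri e]]]]] neq]; move: e.
rewrite !isoclass_indrep /ind_length => ->.
rewrite -[X in (X < _)%N]addn0 ltn_add2l lt0n; apply: contra_notN neq.
by move=> /eqP /T0 M0; exact/isomorphic_indrep/(zero_cone_iso M0 tri).
Qed.

Lemma ind_le_length X Y :
  ind_le Theta X Y -> (ind_length Theta X <= ind_length Theta Y)%N.
Proof.
by have [->|/eqP neq] := eqVneq X Y => // XY; exact/ltnW/ind_lt_length.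
Qed.

(** In a chain, maximal means greatest; strict growth of the length replaces antisymmetry in the
    converse. *)
Lemma Ch_ind_maxP X S :
  Ch_ind_max Theta X S <->
  [/\ Ch_ind Theta S, X \in S & forall Y, Y \in S -> ind_le Theta Y X].
Proof.
split=> -[ch XS le]; split=> // Y YS.
  have [//|XY] := ch Y X YS XS.
  have [->|/eqP neq] := eqVneq X Y; first exact: ind_le_refl.
  by case: (le Y YS).
by move=> /ind_lt_length; rewrite ltnNge ind_le_length //; exact: le.
Qed.

Lemma Ch_ind_max_fset1 X : Ch_ind_max Theta X [fset X]%fset.
Proof.
apply/Ch_ind_maxP; split; rewrite ?in_fset1 //.
  by move=> Y Z /fset1P -> /fset1P ->; left; exact: ind_le_refl.
by move=> Y /fset1P ->; exact: ind_le_refl.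
Qed.

Lemma Ch_ind_max_fset1U X Y S :
  Ch_ind_max Theta X S -> ind_le Theta X Y -> Ch_ind_max Theta Y (Y |` S)%fset.
Proof.
move=> /Ch_ind_maxP[ch XS le] XY.
have leY Z : Z \in (Y |` S)%fset -> ind_le Theta Z Y.
  rewrite in_fset1U => /orP[/eqP ->|/le ZX]; first exact: ind_le_refl.
  exact: ind_le_trans ZX XY.
apply/Ch_ind_maxP; split=> //; last by rewrite fset1U1.
move=> Z W ZS WS; move: (ZS) (WS); rewrite !in_fset1U.
move=> /orP[/eqP -> _|Z'S /orP[/eqP ->|W'S]]; first by right; exact: leY.
  by left; exact: leY.
exact: ch.
Qed.

Lemma Ch_ind_max_ex S :
  Ch_ind Theta S -> S != fset0 -> exists2 X, X \in S & Ch_ind_max Theta X S.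
Proof.
move=> ch /fset0Pn[X0 X0S].
pose r Z W := (ind_length Theta Z <= ind_length Theta W)%N.
have rtot : total r by move=> Z W; exact: leq_total.
have rtrans : transitive r by move=> Z W V; exact: leq_trans.
have exS : exists2 Z, Z \in enum_fset S & Z \in S by exists X0.
have [X [XS Xmax]] := seq_max rtot rtrans exS.
exists X => //; split=> // Y YS /ind_lt_length.
by rewrite ltnNge => /negP; apply; exact: Xmax.
Qed.

(** * The Gabriel-Roiter measure and its three properties *)

Lemma chain_lengthP S n :
  reflect (exists2 X, X \in S & n = ind_length Theta X)
          (n \in chain_length Theta S).
Proof. exact: imfsetP. Qed.

Lemma chain_length_le X S n :
  Ch_ind_max Theta X S -> n \in chain_length Theta S ->
  (n <= ind_length Theta X)%N.
Proof.
by move=> /Ch_ind_maxP[_ _ le] /chain_lengthP[Y /le /ind_le_length ? ->].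
Qed.

Lemma GR_measureP X :
  (exists2 S, Ch_ind_max Theta X S & chain_length Theta S = GR_measure Theta X) /\
  (forall S, Ch_ind_max Theta X S ->
     lex_le (chain_length Theta S) (GR_measure Theta X)).
Proof.
pose L := [set chain_length Theta S | S in Ch_ind_max Theta X]%classic.
(* All candidate sets of lengths are subsets of the numbers from 0 to the length of [X], so a
   maximum is sought in a finite powerset. *)
pose B := [fset n in iota 0 (ind_length Theta X).+1]%fset.
have LB U : L U -> U \in fpowerset B.
  move=> [S XS <-]; rewrite fpowersetE; apply/fsubsetP => n nS.
  rewrite in_fset mem_iota; exact: (chain_length_le XS nS).
have L1 : L (chain_length Theta [fset X]%fset).
  by exists [fset X]%fset => //; exact: Ch_ind_max_fset1.
have Lex : exists2 U, U \in enum_fset (fpowerset B) & L U.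
  by exists (chain_length Theta [fset X]%fset) => //; exact: LB.
have [U [LU Umax]] := seq_max lex_le_total lex_le_trans Lex.
have [LG Gmax] : [set m | L m /\ forall m', L m' -> lex_le m' m]%classic
    (GR_measure Theta X).
  by apply: (xgetPex fset0); exists U; split=> // m' Lm';
    exact: Umax (LB _ Lm') Lm'.
split; first by case: LG => S XS eS; exists S.
by move=> S XS; apply: Gmax; exists S.
Qed.

(** Together with [GR_measure_le] this identifies the length of [X] as the largest element of its
    measure, which yields (GR2). *)
Lemma GR_measure_mem X : ind_length Theta X \in GR_measure Theta X.
Proof.
by have [[S [_ XS _] <-] _] := GR_measureP X; apply/chain_lengthP; exists X.
Qed.

Lemma GR_measure_le X n :
  n \in GR_measure Theta X -> (n <= ind_length Theta X)%N.
Proof. by have [[S XS <-] _] := GR_measureP X; exact: chain_length_le. Qed.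

Lemma GR1 X Y :
  ind_le Theta X Y -> lex_le (GR_measure Theta X) (GR_measure Theta Y).
Proof.
move=> XY; have [[S XS <-] _] := GR_measureP X; have [_ Ymax] := GR_measureP Y.
(* Adding [Y] to a chain that realizes the measure of [X] only enlarges its set of lengths. *)
apply: (lex_le_trans _ (Ymax _ (Ch_ind_max_fset1U XS XY))).
apply: lex_le_sub => n /chain_lengthP[Z ZS ->].
by apply/chain_lengthP; exists Z => //; rewrite in_fset1U ZS orbT.
Qed.

Lemma GR2 X Y :
  GR_measure Theta X = GR_measure Theta Y ->
  ind_length Theta X = ind_length Theta Y.
Proof.
move=> e; apply/eqP; rewrite eqn_leq !GR_measure_le //.
  by rewrite e GR_measure_mem.
by rewrite -e GR_measure_mem.
Qed.

Lemma GR3 X Y :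
  (ind_length Theta Y <= ind_length Theta X)%N ->
  (forall X', ind_lt Theta X' X ->
     lex_lt (GR_measure Theta X') (GR_measure Theta Y)) ->
  lex_le (GR_measure Theta X) (GR_measure Theta Y).
Proof.
move=> YX below; have [[S /Ch_ind_maxP[ch XS le] <-] _] := GR_measureP X.
pose S' := (S `\ X)%fset.
have S'P Z : Z \in S' -> Z \in S /\ ind_lt Theta Z X.
  by rewrite !inE => /andP[/eqP ? ZS]; do !split=> //; exact: le.
have -> : chain_length Theta S =
    (ind_length Theta X |` chain_length Theta S')%fset.
  by rewrite /chain_length -[in LHS](fsetD1K XS) imfsetU1.
apply: lex_le_fset1U.
- have [S'0|S'n0] := eqVneq S' fset0.
    (* With nothing left below [X], the empty set is strictly smaller than the measure of [Y], which
       contains the length of [Y]. *)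
    rewrite S'0 /chain_length imfset0 /lex_lt lex_le_sub //=.
    by apply/eqP => e; have := GR_measure_mem Y; rewrite -e.
  have chS' : Ch_ind Theta S'.
    by move=> Z W /S'P[ZS _] /S'P[WS _]; exact: ch.
  (* The remaining chain competes for the measure of its top [X'], to which the hypothesis
     applies. *)
  have [X' /S'P[_ X'X] X'S'] := Ch_ind_max_ex chS' S'n0.
  have [_ /(_ _ X'S') S'X'] := GR_measureP X'.
  have /andP[X'Y neq] := below X' X'X.
  (* For strictness: if the remaining lengths equalled the measure of [Y], the measure of [X'] would
     be squeezed to the same value. *)
  rewrite /lex_lt (lex_le_trans S'X' X'Y); apply: contraNneq neq => e.
  by apply/eqP/lex_le_anti; rewrite X'Y -e.
- by move=> k /chain_lengthP[Z /S'P[_ ZX] ->]; exact: ind_lt_length.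
- by move=> k /GR_measure_le kY; exact: leq_trans YX.
Qed.

End Length.

Theorem proposition3p5 (A : extData) (Theta : Iso A -> nat)
    (hA : length_category Theta) (X Y : ind A) :
  [/\ ind_le Theta X Y ->
        lex_le (GR_measure Theta X) (GR_measure Theta Y),
      GR_measure Theta X = GR_measure Theta Y ->
        ind_length Theta X = ind_length Theta Y
    & (ind_length Theta Y <= ind_length Theta X)%N ->
        (forall X' : ind A, ind_lt Theta X' X ->
           lex_lt (GR_measure Theta X') (GR_measure Theta Y)) ->
        lex_le (GR_measure Theta X) (GR_measure Theta Y)].
Proof. by split; [exact: GR1 | exact: GR2 | exact: GR3]. Qed.
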